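(* Let $(V,X,d)$ be a symmetric continuity space, i.e. a continuity space with $d(x,y)=d(y,x)$ for all $x,y\in X$. Then the topology on $X$ generated by $(V,X,d)$ is completely regular.
   Context: For a complete lattice $L$ with bottom $\bot$ and $x,y\in L$, write $y\succ x$ (equivalently $x\prec y$; ''$y$ is well above $x$'') if whenever $S\subseteq L$ and $x\ge\bigwedge S$, there is $s\in S$ with $y\ge s$. A value distributive lattice is a completely distributive complete lattice $L$ for which $L_\prec=\{a\in L\mid a\succ\bot\}$ is a filter. A value quantale is a value distributive lattice $V$ with an associative commutative binary operation $+:V\times V\to V$ such that $x+\bot=x$ for all $x\in V$ and $\bigwedge(x+S)=x+\bigwedge S$ for all $x\in V$, $S\subseteq V$. A continuity space $(V,X,d)$ consists of a value quantale $V$, a set $X$ and a function $d:X\times X\to V$ with $d(x,x)=\bot$ and $d(x,z)\le d(x,y)+d(y,z)$ for all $x,y,z\in X$. For $\epsilon\succ\bot$ put $B_\epsilon(x)=\{y\in X\mid d(x,y)\prec\epsilon\}$. The topology generated by $(V,X,d)$, denoted $\mathcal{O}[(V,X,d)]$, consists of those $U\subseteq X$ such that for every $x\in U$ there is $\epsilon\succ\bot$ with $B_\epsilon(x)\subseteq U$. A topology is completely regular if points and closed sets not containing them can be separated by continuous $[0,1]$-valued functions; no separation axiom such as $T_0$ or $T_1$ is included. *)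

(* Defs.v *)
From HB Require Import structures.
From mathcomp Require Import all_boot all_order all_algebra.
From mathcomp Require Import boolp classical_sets set_interval reals.
From mathcomp Require Import topology normedtype.

Set Implicit Arguments.
Unset Strict Implicit.
Unset Printing Implicit Defensive.

Import Order.TTheory GRing.Theory Num.Theory.
Import numFieldNormedType.Exports.

Local Open Scope classical_set_scope.
Local Open Scope order_scope.

(* [S] ranges over all subsets, including [set0]: [cinf set0] is [\top]
   and [csup set0] is [\bot]. *)
HB.mixin Record TBLattice_isComplete d L of Order.TBLattice d L := {
  cinf : set L -> L;
  csup : set L -> L;
  cinfP : forall S : set L, infimums S (cinf S);
  csupP : forall S : set L, supremums S (csup S)
}.

#[short(type="completeLatticeType")]
HB.structure Definition CompleteLattice d :=
  { L of Order.TBLattice d L & TBLattice_isComplete d L }.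

Section CompleteLatticeDefs.
Context {d : Order.disp_t} {L : completeLatticeType d}.

(* [well_above y x] is y ≻ x, equivalently x ≺ y. *)
Definition well_above (y x : L) : Prop :=
  forall S : set L, cinf S <= x -> exists2 s, S s & s <= y.

(* A filter is nonempty but need not be proper: [\bot] may be well above
   itself, as in the two-element lattice. *)
Definition order_filter (F : set L) : Prop :=
  [/\ F !=set0,
      forall a b, F a -> a <= b -> F b
    & forall a b, F a -> F b -> F (Order.meet a b)].

End CompleteLatticeDefs.

Definition completely_distributive d (L : completeLatticeType d) : Prop :=
  forall (J : Type) (K : J -> Type) (x : forall j, K j -> L),
    cinf (range (fun j => csup (range (x j)))) =
    csup (range (fun f : forall j, K j => cinf (range (fun j => x j (f j))))).

HB.mixin Record CompleteLattice_isValueDistr d L of CompleteLattice d L := {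
  cdistr_law : completely_distributive L;
  well_above_bot_filter : order_filter [set a : L | well_above a \bot]
}.

#[short(type="valueDistrLatticeType")]
HB.structure Definition ValueDistrLattice d :=
  { L of CompleteLattice d L & CompleteLattice_isValueDistr d L }.

HB.mixin Record ValueDistrLattice_isQuantale d V of ValueDistrLattice d V := {
  vadd : V -> V -> V;
  vaddA : associative vadd;
  vaddC : commutative vadd;
  vaddx0 : right_id \bot vadd;
  vadd_cinf : forall (x : V) (S : set V), cinf (vadd x @` S) = vadd x (cinf S)
}.

#[short(type="valueQuantaleType")]
HB.structure Definition ValueQuantale d :=
  { V of ValueDistrLattice d V & ValueDistrLattice_isQuantale d V }.

Record continuitySpace d (V : valueQuantaleType d) := ContinuitySpace {
  cs_point :> Type;
  cs_dist : cs_point -> cs_point -> V;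
  cs_distxx : forall x, cs_dist x x = \bot;
  cs_triangle : forall x y z,
    cs_dist x z <= vadd (cs_dist x y) (cs_dist y z)
}.

Section GeneratedTopology.
Context {d : Order.disp_t} {V : valueQuantaleType d} (X : continuitySpace V).

Definition symmetric_space : Prop := forall x y : X, cs_dist x y = cs_dist y x.

Definition cs_ball (eps : V) (x : X) : set X :=
  [set y | well_above eps (cs_dist x y)].

Definition cs_open (U : set X) : Prop :=
  forall x, U x -> exists2 eps, well_above eps \bot & cs_ball eps x `<=` U.

Lemma well_above_le (a b c : V) : well_above a c -> a <= b -> well_above b c.
Proof.
by move=> ac ab S /ac[s Ss sa]; exists s => //; exact: le_trans ab.
Qed.

Lemma cs_openT : cs_open setT.
Proof.
by have [[e e0] _ _] := @well_above_bot_filter d V => x _; exists e.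
Qed.

Lemma cs_openI : setI_closed cs_open.
Proof.
have [_ _ fI] := @well_above_bot_filter d V.
move=> A B oA oB x [/oA[e e0 eA] /oB[e' e'0 eB]].
exists (Order.meet e e'); first exact: fI.
by move=> y xy; split; [apply: eA | apply: eB]; apply: well_above_le xy _;
  rewrite ?leIl ?leIr.
Qed.

Lemma cs_open_bigcup (I : Type) (f : I -> set X) :
  (forall i, cs_open (f i)) -> cs_open (\bigcup_i f i).
Proof.
move=> of_ x [i _ /(of_ i)[e e0 ef]]; exists e => //.
by move=> y /ef fy; exists i.
Qed.

(* The points of [X], carrying the topology generated by [X]; the open sets
   are exactly those satisfying [cs_open]. *)
Definition generated_space : Type := X.

HB.instance Definition _ := gen_eqMixin generated_space.
HB.instance Definition _ := gen_choiceMixin generated_space.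
HB.instance Definition _ := isOpenTopological.Build generated_space
  cs_openT cs_openI cs_open_bigcup.

End GeneratedTopology.

(* The library's [completely_regular_space] separates by a uniformity instead
   of by functions. No separation axiom is imposed on [T]. *)
Definition completely_regular (R : realType) (T : topologicalType) : Prop :=
  forall (a : T) (B : set T), closed B -> ~ B a ->
    exists f : T -> R,
      [/\ continuous f, range f `<=` `[0%R, 1%R]%classic,
          f a = 0%R & forall b, B b -> f b = 1%R].

(* Main.v *)
Require Import Defs.
From mathcomp Require Import all_boot all_order reals topology.
From HB Require Import structures.
From mathcomp Require Import boolp classical_sets filter normedtype.

(** A symmetric [V]-valued distance makes the sets
    [{(x, y) | d(x, y) ≺ eps}], for [eps ≻ \bot], a base of a uniformity
    inducing the generated topology, and Urysohn's construction separates
    points from closed sets in any uniform space.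

    The axioms of a uniformity are immediate (symmetry of [d] gives the
    inverses, the filter axiom on [L_≺] the intersections) except for the
    halving of entourages, [well_above_bot_half]: below each [eps ≻ \bot] there
    is [delta ≻ \bot] such that [a ≺ delta] and [b ≺ delta] imply
    [a + b ≺ eps].  This is where the structure of [V] enters.  By complete
    distributivity every element is the infimum of the elements well above it
    ([cinf_well_above]); applied to [\bot], and since [+] commutes with
    infima, this gives [inf {p + q | p, q ≻ \bot} = \bot + \bot = \bot], so any
    element well above [\bot] dominates some [p + q].  Applied twice, it also
    gives an element of [L_≺] strictly between [\bot] and [eps], which turns
    the resulting [a + b <= p + q] into [a + b ≺ eps].

    The triangle inequality and halving show that every ball is a
    neighbourhood of its centre ([nbhs_cs_ball]), so the uniform topology is
    no finer than the generated one; a closed set avoids a ball around each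
    point outside it by definition. *)

Set Implicit Arguments.
Unset Strict Implicit.
Unset Printing Implicit Defensive.

Import Order.TTheory.

Local Open Scope classical_set_scope.
Local Open Scope order_scope.

Section CompleteLatticeTheory.
Context {d : Order.disp_t} {L : completeLatticeType d}.
Implicit Types (S : set L) (x y z : L).

Lemma cinf_le S x : S x -> cinf S <= x.
Proof. by have [lb _] := cinfP S; exact: lb. Qed.

Lemma le_cinf S x : (forall s, S s -> x <= s) -> x <= cinf S.
Proof. by have [_ glb] := cinfP S => xS; exact: glb. Qed.

Lemma le_csup S x : S x -> x <= csup S.
Proof. by have [ub _] := csupP S; exact: ub. Qed.

Lemma csup_le S x : (forall s, S s -> s <= x) -> csup S <= x.
Proof. by have [_ lub] := csupP S => Sx; exact: lub. Qed.

Lemma well_aboveW y x : well_above y x -> x <= y.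
Proof.
by move=> /(_ [set x])[|_ -> //]; exact: cinf_le.
Qed.

Lemma le_well_above y x z : well_above y x -> z <= x -> well_above y z.
Proof. by move=> yx zx S Sz; apply: yx; exact: le_trans zx. Qed.

(** Complete distributivity is self-dual.  Expanding the right-hand side by
    the given law turns it into a supremum over functions [g] assigning to each
    choice function [f] an index [g f]; a diagonal argument provides for each
    [g] an index [j] such that every [k : K j] is the value at [j] of some [f]
    with [g f = j], whence the corresponding term is at most
    [inf_k (x j k)]. *)
Lemma completely_distributive_dual (cdL : completely_distributive L)
    (J : Type) (K : J -> Type) (x : forall j, K j -> L) :
  csup (range (fun j => cinf (range (x j)))) =
  cinf (range (fun f : forall j, K j => csup (range (fun j => x j (f j))))).
Proof.
apply/le_anti/andP; split.
  apply: csup_le => _ [j _ <-]; apply: le_cinf => _ [f _ <-].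
  apply: (@le_trans _ _ (x j (f j))); first by apply: cinf_le; exists (f j).
  by apply: le_csup; exists j.
rewrite (cdL _ _ (fun (f : forall j, K j) j => x j (f j))).
apply: csup_le => _ [g _ <-].
have [j jP] : exists j, forall k : K j, exists2 f : forall j, K j,
    g f = j & x (g f) (f (g f)) = x j k.
  (* Otherwise choose at each [j] a missed value: the resulting choice
     function [f0] attains its own missed value at [g f0]. *)
  apply: contrapT => noj.
  have missed j : {k : K j | forall f : forall j, K j,
      g f = j -> x (g f) (f (g f)) = x j k -> False}.
    apply: cid; apply: contrapT => nok; apply: noj; exists j => k.
    apply: contrapT => nof; apply: nok; exists k => f gf xf.
    by apply: nof; exists f.
  pose f0 j := sval (missed j).
  exact: (svalP (missed (g f0)) f0).
apply: (@le_trans _ _ (cinf (range (x j)))); last by apply: le_csup; exists j.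
apply: le_cinf => _ [k _ <-]; have [f _ <-] := jP k.
by apply: cinf_le; exists f.
Qed.

(** Apply the dual law to the family of all sets [S] with [inf S <= x]: the
    supremum of their infima is [x], and for each choice function [f] the
    supremum of the [f S] is well above [x], since it bounds a member of every
    such [S]. *)
Lemma cinf_well_above (cdL : completely_distributive L) x :
  cinf [set y | well_above y x] = x.
Proof.
apply/le_anti/andP; split; last by apply: le_cinf => y /well_aboveW.
pose J := {S : set L | cinf S <= x}; pose K (j : J) := {s | sval j s}.
apply: (@le_trans _ _ (csup (range (fun j : J => cinf (range
    (fun k : K j => sval k)))))); last first.
  apply: csup_le => _ [[S Sx] _ <-]; apply: (le_trans _ Sx).
  by apply: le_cinf => s Ss; apply: cinf_le; exists (exist _ s Ss).
rewrite completely_distributive_dual //.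
apply: le_cinf => _ [f _ <-]; apply: cinf_le => S Sx.
pose j : J := exist _ S Sx.
exists (sval (f j)); first exact: svalP (f j).
by apply: le_csup; exists j.
Qed.

Lemma well_above_interpolate (cdL : completely_distributive L) y x :
  well_above y x -> exists2 z, well_above y z & well_above z x.
Proof.
move=> /(_ [set s | exists2 z, well_above s z & well_above z x])[|s [z sz zx]].
  rewrite -[leRHS](cinf_well_above cdL x); apply: le_cinf => z zx.
  rewrite -[leRHS](cinf_well_above cdL z); apply: le_cinf => s sz.
  by apply: cinf_le; exists z.
move=> sy; exists z => // S /sz[t St ts].
by exists t => //; exact: le_trans sy.
Qed.

End CompleteLatticeTheory.

Section ValueQuantaleTheory.
Context {d : Order.disp_t} {V : valueQuantaleType d}.
Implicit Types a b eps : V.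

Lemma le_vaddl c a b : a <= b -> vadd c a <= vadd c b.
Proof.
move=> ab; have <- : cinf [set a; b] = a.
  apply/le_anti/andP; split; first by apply: cinf_le; left.
  by apply: le_cinf => _ [|] ->.
by rewrite -vadd_cinf; apply: cinf_le; exists b => //; right.
Qed.

Lemma le_vadd a a' b b' : a <= a' -> b <= b' -> vadd a b <= vadd a' b'.
Proof.
move=> aa' bb'; apply: (le_trans (le_vaddl _ bb')).
by rewrite ![vadd _ b']vaddC; exact: le_vaddl.
Qed.

Lemma well_above_bot_meet a b :
  well_above a \bot -> well_above b \bot -> well_above (Order.meet a b) \bot.
Proof. by have [_ _] := @well_above_bot_filter d V; apply. Qed.

Lemma well_above_bot_half eps : well_above eps \bot ->
  exists2 delta, well_above delta \bot & forall a b,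
    well_above delta a -> well_above delta b -> well_above eps (vadd a b).
Proof.
move=> /(well_above_interpolate (@cdistr_law d V))[eta eps_eta eta0].
have bot_inf := cinf_well_above (@cdistr_law d V) (\bot : V).
have := eta0 [set s | exists p q : V,
  [/\ well_above p \bot, well_above q \bot & s = vadd p q]].
case=> [|_ [p [q [p0 q0 ->]]] pq_eta].
  rewrite -[leRHS]bot_inf; apply: le_cinf => p p0.
  have -> : p = cinf (vadd p @` [set q | well_above q \bot]).
    by rewrite vadd_cinf bot_inf vaddx0.
  by apply: le_cinf => _ [q q0 <-]; apply: cinf_le; exists p, q.
exists (Order.meet p q); first exact: well_above_bot_meet.
move=> a b /well_aboveW + /well_aboveW; rewrite !lexI => /andP[ap _] /andP[_ bq].
by apply: le_well_above eps_eta _; apply: le_trans pq_eta; exact: le_vadd.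
Qed.

End ValueQuantaleTheory.

Section SymmetricSpace.
Context {d : Order.disp_t} {V : valueQuantaleType d} (X : continuitySpace V).

Lemma cs_ball_split eps : well_above eps \bot ->
  exists2 delta, well_above delta \bot & forall x y z : X,
    cs_ball delta x y -> cs_ball delta y z -> cs_ball eps x z.
Proof.
move=> /well_above_bot_half[delta delta0 deltaP]; exists delta => // x y z xy yz.
by apply: le_well_above (cs_triangle _ y _); exact: deltaP.
Qed.

(** The points having a whole ball inside the given one form an open set, by
    halving. *)
Lemma nbhs_cs_ball eps (x : generated_space X) :
  well_above eps \bot -> nbhs x (cs_ball eps x : set (generated_space X)).
Proof.
move=> eps0; rewrite nbhsE.
exists [set y | exists2 e, well_above e \bot & cs_ball e y `<=` cs_ball eps x].
  split; last by exists eps.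
  move=> y [e /cs_ball_split[e' e'0 splite] yx]; exists e' => // z yz.
  by exists e' => // t zt; apply: yx; exact: splite zt.
by move=> y [e e0]; apply; rewrite /cs_ball /= cs_distxx.
Qed.

Definition cs_entourage : set_system (X * X) :=
  filter_from [set eps : V | well_above eps \bot]
              (fun eps => [set xy | cs_ball eps xy.1 xy.2]).

Lemma cs_entourage_filter : Filter cs_entourage.
Proof.
apply: filter_from_filter => [|a b a0 b0].
  by have [[e e0] _ _] := @well_above_bot_filter d V; exists e.
exists (Order.meet a b); first exact: well_above_bot_meet.
by move=> xy mxy; split; apply: well_above_le mxy _; rewrite ?leIl ?leIr.
Qed.

Lemma cs_entourage_diagonal A : cs_entourage A -> diagonal `<=` A.
Proof.
move=> [e e0 eA] [x y]; rewrite /diagonal /= => <-; apply: eA.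
by rewrite /= /cs_ball /= cs_distxx.
Qed.

Lemma cs_entourage_split_ex A : cs_entourage A ->
  exists2 B, cs_entourage B & (B \; B `<=` A)%relation.
Proof.
move=> [e /cs_ball_split[e' e'0 splite] eA].
exists [set xy | cs_ball e' xy.1 xy.2]; first by exists e'.
by move=> [x z] [y xy yz]; apply: eA; exact: splite yz.
Qed.

Hypothesis symX : symmetric_space X.

Lemma cs_entourage_inv A : cs_entourage A -> cs_entourage (A^-1)%relation.
Proof.
move=> [e e0 eA]; exists e => // -[x y] xy; apply: eA.
by rewrite /= /cs_ball /= symX.
Qed.

(** Kept apart from [generated_space X], whose topology only has to be finer
    than this one for separation to carry over.  The vacuous [let] records the
    symmetry hypothesis in the type, where the uniform structure finds it. *)
Definition cs_uniform_space : Type := let _ := symX in cs_point X.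

HB.instance Definition _ := gen_eqMixin cs_uniform_space.
HB.instance Definition _ := gen_choiceMixin cs_uniform_space.
HB.instance Definition _ := isUniform.Build cs_uniform_space
  cs_entourage_filter cs_entourage_diagonal cs_entourage_inv
  cs_entourage_split_ex.

Lemma uniform_separator_generated_space (a : generated_space X)
    (B : set (generated_space X)) :
  closed B -> ~ B a -> uniform_separator [set a] B.
Proof.
rewrite -openC => oB /oB[e e0 eB].
exists (Uniform.class cs_uniform_space), [set xy | cs_ball e xy.1 xy.2]; split.
- by exists e.
- by rewrite -subset0 => -[_ b] [[/= -> Bb]] /eB.
- move=> x U [E [e' e'0 e'E] EU].
  apply: (filterS _ (nbhs_cs_ball (x : generated_space X) e'0)) => y xy.
  by apply/EU/xsectionP; exact: e'E.
Qed.

End SymmetricSpace.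

Theorem lemma18 (R : realType) (d : Order.disp_t) (V : valueQuantaleType d)
  (X : continuitySpace V) (hX : symmetric_space X) :
  completely_regular R (generated_space X).
Proof.
move=> a B clB Ba.
have /(@uniform_separatorP _ R)[f [cf f01 fa fB]] :=
  uniform_separator_generated_space hX clB Ba.
exists f; split=> // [|b Bb]; first by apply: fa; exists a.
by apply: fB; exists b.
Qed.
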